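(* Under the standing assumptions listed in the context, let $(x_k)_{k\in\mathbb N}$ be the exact-data AVEK iteration $$x_{k+1}=\frac1n\sum_{\ell=k-n+1}^{k}\Bigl(x_\ell-s_\ell F_{[\ell]}'(x_\ell)^*\bigl(F_{[\ell]}(x_\ell)-y_{[\ell]}\bigr)\Bigr)\qquad (k\ge n),$$ with initial values $x_1,\dots,x_n\in B_{\rho/3}(x_0)$ and step sizes $s_k>0$ satisfying $s_k\|F_i'(x)\|^2\le 1$ for all $i\in\{1,\dots,n\}$, all $k$ and all $x\in B_\rho(x_0)$, and $\inf\{s_k\mid k\in\mathbb N\}>0$. Then the following hold. (a) $x_k\rightharpoonup x^*$ (weakly) as $k\to\infty$, where $x^*\in B_\rho(x_0)$ is a solution of the system $F_i(x)=y_i$, $i=1,\dots,n$. (b) If the initialisation is chosen as $x_1=\cdots=x_n=x_0$, and $$\mathcal N\bigl(F'(x^+)\bigr)\subseteq\mathcal N\bigl(F'(x)\bigr)\quad\text{for all }x\in B_\rho(x_0),$$ where $x^+$ is an $x_0$-minimal norm solution of the system, then $x_k\rightharpoonup x^+$ as $k\to\infty$.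
   Context: Setting: $n\ge1$ is an integer, $\mathbb X,\mathbb Y_1,\dots,\mathbb Y_n$ are Hilbert spaces, $F_i:\mathcal D(F_i)\subseteq\mathbb X\to\mathbb Y_i$ ($i=1,\dots,n$) are continuously Fréchet differentiable maps, and $F=(F_i)_{i=1}^n$ takes values in $\mathbb Y=\prod_{i=1}^n\mathbb Y_i$. Exact data $y=(y_i)_{i=1}^n\in\mathbb Y$ are given; a solution is an $x$ with $F_i(x)=y_i$ for all $i$. $F_i'(x)^*$ is the Hilbert space adjoint of the derivative, $\mathcal N(\cdot)$ is the null space, $B_r(x_0)=\{x\in\mathbb X\mid\|x-x_0\|\le r\}$, and $[k]=((k-1)\bmod n)+1\in\{1,\dots,n\}$. Standing assumptions: (1) there are $x_0\in\mathbb X$, $\rho>0$ with $B_\rho(x_0)\subseteq\bigcap_{i}\mathcal D(F_i)$; (2) $\sup\{\|F_i'(x)\|\mid x\in B_\rho(x_0)\}<\infty$ for every $i$; (3) for every $i$ there is $\eta_i\in[0,1/2)$ such that $\|F_i(x_1)-F_i(x_2)-F_i'(x_1)(x_1-x_2)\|\le\eta_i\|F_i(x_1)-F_i(x_2)\|$ for all $x_1,x_2\in B_\rho(x_0)$; (4) there exists a solution in $B_{\rho/3}(x_0)$. An $x_0$-minimal norm solution is a solution $x^+\in B_\rho(x_0)$ with $\|x^+-x_0\|=\inf\{\|x-x_0\|\mid x\in B_\rho(x_0),\ F(x)=y\}$. *)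

(* Defs.v *)
From HB Require Import structures.
From mathcomp Require Import all_boot all_order all_algebra.
From mathcomp Require Import all_classical all_reals all_analysis.

Set Implicit Arguments.
Unset Strict Implicit.
Unset Printing Implicit Defensive.

Import Order.TTheory GRing.Theory Num.Theory.
Import numFieldNormedType.Exports.

Local Open Scope classical_set_scope.
Local Open Scope ring_scope.

(* Real Hilbert spaces. Complex ones are covered by restriction of scalars with
   the inner product Re <x, y>: this changes neither the norm, nor adjoints of
   complex linear operators, nor weak convergence, nor null spaces. *)
HB.mixin Record CompleteNormedModule_isHilbert (R : realType) V
    of CompleteNormedModule R V := {
  inner : V -> V -> R ;
  innerC : forall u v, inner u v = inner v u ;
  innerDl : forall u v w, inner (u + v) w = inner u w + inner v w ;
  innerZl : forall (a : R) u v, inner (a *: u) v = a * inner u v ;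
  inner_norm : forall u, inner u u = `|u| ^+ 2
}.

#[short(type="hilbertType")]
HB.structure Definition Hilbert (R : realType) :=
  { V of CompleteNormedModule_isHilbert R V & CompleteNormedModule R V }.

Definition cball (R : realType) (X : hilbertType R) (c : X) (r : R) : set X :=
  [set x | `|x - c| <= r].

Definition opnorm (R : realType) (X Y : hilbertType R) (A : X -> Y) : R :=
  sup [set `|A h| | h in [set h : X | `|h| <= 1]].

(* Chosen with [xget]; it is the adjoint as soon as [A] is linear and
   continuous. *)
Definition adjoint (R : realType) (X Y : hilbertType R) (A : X -> Y) (v : Y) : X :=
  xget 0 [set u : X | forall h, inner (A h) v = inner h u].

Definition weak_cvg (R : realType) (X : hilbertType R) (u : nat -> X) (l : X) :
    Prop :=
  forall f : {linear X -> R^o}, continuous f -> f (u k) @[k --> \oo] --> f l.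

(* A partial map on [D] is a total function whose values outside [D] are
   irrelevant. To ensure this without requiring [D] to be open, the limit
   defining the derivative is taken within [D]; see [is_frechetP] for the link
   with the library's differential. *)
Definition is_frechet (R : realType) (X Y : hilbertType R) (D : set X)
    (f : X -> Y) (x : X) (A : {linear X -> Y}) : Prop :=
  continuous A /\
  forall e : R, 0 < e -> \forall z \near within D (nbhs x),
    `|f z - f x - A (z - x)| <= e * `|z - x|.

Lemma is_frechetP (R : realType) (X Y : hilbertType R) (D : set X)
    (f : X -> Y) (x : X) (A : {linear X -> Y}) :
  nbhs x D -> is_frechet D f x A <-> is_diff x f A.
Proof.
move=> Dx.
have withinE (B : set X) : within D (nbhs x) B <-> nbhs x B.
  split=> /= [DB|]; last exact: cvg_within.
  by apply: filterS2 Dx DB => z Dz; apply.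
have shiftE (P : set X) : nbhs x P <-> nbhs (0 : X) (P \o shift x).
  by have := near_shift 0 x P; rewrite subr0 /prop_near1 /= => ->.
have key : (forall e : R, 0 < e -> \forall z \near within D (nbhs x),
      `|f z - f x - A (z - x)| <= e * `|z - x|) <->
    f \o shift x = cst (f x) + A +o_ 0 id.
  rewrite eqaddoP; split=> [H e e_gt0|H e e_gt0].
    have /withinE/shiftE := H e e_gt0; apply: filterS => z /=.
    by rewrite /shift/= addrK !fctE opprD addrA.
  apply/withinE/shiftE; move: (H e e_gt0); apply: filterS => z /=.
  by rewrite /shift/= addrK !fctE opprD addrA.
split=> [[cA /key o]|df].
  have dE : 'd f x = A :> (X -> Y) by exact: diff_unique.
  by split=> //; apply/diff_locallyP; rewrite dE.
have dE : 'd f x = A :> (X -> Y) by exact: diff_val.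
have /diff_locallyP[cd o] : differentiable f x by exact: ex_diff.
by rewrite dE in cd o; split=> //; apply/key.
Qed.

Definition continuously_frechet (R : realType) (X Y : hilbertType R)
    (D : set X) (f : X -> Y) (df : X -> {linear X -> Y}) : Prop :=
  forall x, D x -> is_frechet D f x (df x) /\
    opnorm (df z \- df x) @[z --> within D (nbhs x)] --> (0 : R).

(* The null space of h |-> (A_i h)_i with values in the product of the Y_i. *)
Definition null_space (R : realType) (n : nat) (X : hilbertType R)
    (Y : 'I_n -> hilbertType R) (A : forall i, X -> Y i) : set X :=
  [set h | forall i, A i h = 0].

Definition solutions (R : realType) (n : nat) (X : hilbertType R)
    (Y : 'I_n -> hilbertType R) (F : forall i, X -> Y i) (y : forall i, Y i) :
    set X :=
  [set x | forall i, F i x = y i].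

Definition is_min_norm_solution (R : realType) (n : nat) (X : hilbertType R)
    (Y : 'I_n -> hilbertType R) (F : forall i, X -> Y i) (y : forall i, Y i)
    (x0 : X) (rho : R) (xp : X) : Prop :=
  let S := cball x0 rho `&` solutions F y in
  S xp /\ `|xp - x0| = inf [set `|x - x0| | x in S].

(* [k] = ((k - 1) mod n) + 1, where the element i of 'I_n stands for the index
   i + 1 of {1, ..., n}. *)
Definition cyc (n : nat) (n_gt0 : (0 < n)%N) (k : nat) : 'I_n :=
  Ordinal (ltn_pmod k.-1 n_gt0).

(* Main.v *)
Require Import Defs.
From HB Require Import structures.
From mathcomp Require Import all_boot all_order all_algebra.
From mathcomp Require Import all_classical all_reals all_analysis.
From mathcomp Require Import ring lra.

Import Order.TTheory GRing.Theory Num.Theory.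
Import numFieldNormedType.Exports.

Local Open Scope classical_set_scope.
Local Open Scope ring_scope.

(** The iteration is a quasi-Fejer method with memory. Write
    [u_l = x_l - s_l F'(x_l)^* (F(x_l) - y)] for the Landweber step applied to the
    equation that is active at [l]. The tangential cone condition and the bound
    on the step size make each step approach every solution [z] of the ball
    ([landweber_fejer]):
    [|u_l - z|^2 + s_l (1 - 2 eta) |F(x_l) - y|^2 <= |x_l - z|^2].
    The next iterate is the mean of [n] such points, and the [variance] identity
    gives, for [b_k = |x_k - z|^2],
    [n b_(k+1) + d_k <= b_(k-n+1) + ... + b_k],
    where [d_k >= 0] collects the gains of the steps and the squared distances
    of the [u_l] to their mean. A linearly weighted sum of [n] consecutive [b_l]
    decreases by at least [d_k], so [d_k] tends to zero ([window_gap_cvg0]). Hence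
    the active residuals vanish, and so do the increments [x_(k+1) - x_k]. Small
    increments make [b_k] itself converge ([window_cvg]) and, as every equation is
    active once per window, make all the residuals vanish
    ([avek_residual_cvg0]).

    Weak limits of the iterates along ultrafilters of tails are solutions, as the
    cone condition makes each [F i] weakly-strongly closed ([cone_demiclosed]).
    Since the distance to every solution converges, the lemma of [opial] shows
    that there is only one weak limit and that the whole sequence converges to
    it. Existence of weak limits of bounded sequences along ultrafilters, and of
    adjoints, both come from the [riesz] representation theorem.

    For the second part, let [l] be the weak limit and [xp] the minimal norm
    solution. The cone condition puts [l - xp] in the null space of [F'(xp)], hence
    in that of each [F'(z)]. Steps lie in ranges of adjoints, so all [x_k - x0] are
    orthogonal to [l - xp] ([avek_orthogonal]), and so is [l - x0]. By Pythagoras,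
    [|xp - x0|^2 = |l - x0|^2 + |l - xp|^2], and minimality of [xp] gives
    [l = xp] ([min_norm_unique]). *)

(** * Inner products *)

Section InnerProduct.
Context {R : realType} {X : hilbertType R}.
Implicit Types u v w z : X.

Lemma innerDr u v w : inner u (v + w) = inner u v + inner u w.
Proof. by rewrite innerC innerDl !(innerC u). Qed.

Lemma innerZr (a : R) u v : inner u (a *: v) = a * inner u v.
Proof. by rewrite innerC innerZl innerC. Qed.

Lemma innerNl u v : inner (- u) v = - inner u v.
Proof. by rewrite -scaleN1r innerZl mulN1r. Qed.

Lemma innerNr u v : inner u (- v) = - inner u v.
Proof. by rewrite innerC innerNl innerC. Qed.

Lemma innerBl u v w : inner (u - v) w = inner u w - inner v w.
Proof. by rewrite innerDl innerNl. Qed.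

Lemma innerBr u v w : inner u (v - w) = inner u v - inner u w.
Proof. by rewrite innerDr innerNr. Qed.

Lemma inner0l u : inner 0 u = 0.
Proof. by rewrite -(scale0r 0) innerZl mul0r. Qed.

Lemma inner0r u : inner u 0 = 0.
Proof. by rewrite innerC inner0l. Qed.

Lemma inner_suml (I : Type) (r : seq I) (P : pred I) (f : I -> X) v :
  inner (\sum_(i <- r | P i) f i) v = \sum_(i <- r | P i) inner (f i) v.
Proof.
by apply: (big_morph (inner^~ v)) => [a b|]; rewrite ?innerDl ?inner0l.
Qed.

Lemma normD_sqr u v : `|u + v| ^+ 2 = `|u| ^+ 2 + 2 * inner u v + `|v| ^+ 2.
Proof. by rewrite -!inner_norm innerDl !innerDr (innerC v u); ring. Qed.

Lemma normB_sqr u v : `|u - v| ^+ 2 = `|u| ^+ 2 - 2 * inner u v + `|v| ^+ 2.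
Proof. by rewrite normD_sqr innerNr normrN; ring. Qed.

(** Cauchy-Schwarz, from expanding [0 <= | |v| u - |u| v |^2]. *)
Lemma inner_le u v : inner u v <= `|u| * `|v|.
Proof.
have [uv0|uv_neq0] := eqVneq (`|u| * `|v|) 0.
  move/eqP: uv0; rewrite mulf_eq0 !normr_eq0.
  by case/orP=> /eqP ->; rewrite ?inner0l ?inner0r ?normr0 ?mul0r ?mulr0.
have uv_gt0 : 0 < `|u| * `|v| by rewrite lt_def uv_neq0 mulr_ge0.
have := sqr_ge0 `| `|v| *: u - `|u| *: v|.
rewrite normB_sqr !normrZ !normr_id innerZl innerZr => ge0.
rewrite -subr_ge0 -(pmulr_rge0 _ uv_gt0) -(pmulr_rge0 _ (ltr0n _ 2)).
by apply: le_trans ge0 _; lra.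
Qed.

Lemma norm_inner_le u v : `|inner u v| <= `|u| * `|v|.
Proof.
rewrite ler_norml inner_le andbT lerNl -innerNl -(normrN u).
exact: inner_le.
Qed.

Lemma inner_eq0 u : inner u u = 0 -> u = 0.
Proof. by rewrite inner_norm => /eqP; rewrite sqrf_eq0 normr_eq0 => /eqP. Qed.

(** Deviations from the mean sum to zero, so the cross terms cancel. The last sum
    is the gain of averaging: it forces the averaged points together. *)
Lemma variance {n : nat} (u : 'I_n -> X) z : (0 < n)%N ->
  let c := n%:R^-1 *: \sum_i u i in
  \sum_i `|u i - z| ^+ 2 = n%:R * `|c - z| ^+ 2 + \sum_i `|u i - c| ^+ 2.
Proof.
move=> n_gt0 c.
have n_neq0 : n%:R != 0 :> R by rewrite pnatr_eq0 -lt0n.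
have cE : \sum_i (u i - c) = 0.
  by rewrite sumrB sumr_const card_ord -scaler_nat scalerA divff// scale1r subrr.
have split_i i : `|u i - z| ^+ 2 =
    `|u i - c| ^+ 2 + 2 * inner (u i - c) (c - z) + `|c - z| ^+ 2.
  by rewrite -normD_sqr addrA subrK.
under eq_bigr do rewrite split_i.
rewrite !big_split/= sumr_const card_ord -mulr_sumr -inner_suml cE inner0l.
by rewrite mulr0 addr0 mulr_natl addrC.
Qed.

Lemma mean_cball {n : nat} (u : 'I_n -> X) z (r : R) : (0 < n)%N -> 0 <= r ->
  (forall i, `|u i - z| <= r) -> `|n%:R^-1 *: \sum_i u i - z| <= r.
Proof.
move=> n_gt0 r_ge0 ur.
have ur2 : \sum_i `|u i - z| ^+ 2 <= n%:R * r ^+ 2.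
  rewrite mulr_natl -[X in _ *+ X](card_ord n) -sumr_const ler_sum// => i _.
  by rewrite lerXn2r ?nnegrE.
rewrite -(ler_pXn2r (ltn0Sn 1)) ?nnegrE// -(ler_pM2l (_ : 0 < n%:R)) ?ltr0n//.
apply: le_trans ur2; rewrite variance// lerDl.
by apply: sumr_ge0 => i _; rewrite exprn_ge0.
Qed.

End InnerProduct.

(** * Riesz representation and adjoints *)

Lemma cvg_dist_le {R : realType} {V : normedModType R} {T : Type}
    {G : set_system T} (f : T -> V) (l : V) (g : T -> R) : Filter G ->
  (\forall t \near G, `|f t - l| <= g t) -> g @ G --> 0 -> f @ G --> l.
Proof.
move=> FG fg g0; apply/subr_cvg0/norm_cvg0P.
apply: (squeeze_cvgr _ (cvg_cst 0) g0).
by near do rewrite normr_ge0/=.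
Unshelve. all: by end_near. Qed.

Lemma continuous_linear_norm_le {R : realType} {V W : normedModType R}
    (A : {linear V -> W}) :
  continuous A -> exists M, 0 <= M /\ forall h, `|A h| <= M * `|h|.
Proof.
move=> A_cont; have := @continuous_linear_bounded _ _ _ 0 _ (A_cont 0).
move=> /linear_boundedP[M [_ AM]]; exists (`|M| + 1); split.
  by rewrite addr_ge0.
by apply: AM; rewrite (le_lt_trans (ler_norm M)) ?ltrDl.
Qed.

Section Riesz.
Context {R : realType} {X : hilbertType R}.

(** Riesz representation: [L] is represented by the minimiser of
    [J u = |u|^2 - 2 L u]. Minimising sequences are Cauchy by the parallelogram
    identity, and the first-order condition at the minimiser is
    [<u, h> = L h]. *)
Lemma riesz (L : X -> R) (C : R) :
  (forall u v, L (u + v) = L u + L v) ->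
  (forall a u, L (a *: u) = a * L u) ->
  (forall h, `|L h| <= C * `|h|) ->
  exists u, forall h, L h = inner u h.
Proof.
move=> LD LZ LC.
have LB u v : L (u - v) = L u - L v by rewrite LD -scaleN1r LZ mulN1r.
pose J u : R := `|u| ^+ 2 - 2 * L u.
pose m := inf (range J).
have Jlb : has_lbound (range J).
  exists (- C ^+ 2) => _ [u _ <-]; rewrite /J.
  have := LC u; have := ler_norm (L u); have := sqr_ge0 (`|u| - C).
  by set a := `|u|; set b := L u; nra.
have mJ u : m <= J u by apply: ge_inf => //; exists u.
have near_min k : exists u, J u < m + k.+1%:R^-1.
  have [||_ [u _ <-] Ju] := @inf_adherent R (range J) k.+1%:R^-1.
  - by rewrite invr_gt0.
  - by split; first by exists (J 0), 0.
  - by exists u.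
have {near_min} [u Ju] := choice near_min.
have dist_min v w : `|v - w| ^+ 2 <= 2 * (J v - m) + 2 * (J w - m).
  have := mJ (2^-1 *: (v + w)); rewrite /J LZ LD normrZ exprMn normD_sqr.
  rewrite ger0_norm ?invr_ge0// normB_sqr.
  by set a := `|v| ^+ 2; set b := `|w| ^+ 2; set c := inner v w; lra.
have /cauchy_cvgP/cvg_ex[/= l ul] : cauchy (u @ \oo).
  apply: cauchy_exP => e e_gt0.
  have d_gt0 : 0 < e ^+ 2 / 4 by rewrite divr_gt0// exprn_gt0.
  have [N _ NP] := near_infty_natSinv_lt (PosNum d_gt0).
  exists (u N); exists N => // k /= Nk; rewrite -ball_normE/=.
  rewrite -(ltr_pXn2r (ltn0Sn 1)) ?nnegrE ?(ltW e_gt0)//.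
  apply: le_lt_trans (dist_min _ _) _.
  have := NP _ (leqnn N); have := NP _ Nk; have := Ju N; have := Ju k.
  by rewrite /=; set c := k.+1%:R^-1; set d := N.+1%:R^-1; lra.
have Lul : L (u k) @[k --> \oo] --> L l.
  apply: (@cvg_dist_le _ R^o _ _ _ _ (fun k => C * `|u k - l|)).
    by near=> k; rewrite -LB; exact: LC.
  rewrite -(mulr0 C) -(normr0 X) -(subrr l).
  by apply: cvgMl_tmp; apply: cvg_norm; apply: cvgB => //; exact: cvg_cst.
have Jl : J l <= m.
  have Jul : J (u k) @[k --> \oo] --> J l.
    apply: cvgB.
      by apply: (continuous_cvg _ (@exprn_continuous _ 2 _)); exact: cvg_norm.
    by apply: cvgMl_tmp.
  have ml : m + k.+1%:R^-1 @[k --> \oo] --> m.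
    rewrite -[X in _ --> X]addr0.
    by apply: cvgD; [exact: cvg_cst|exact: cvg_harmonic].
  by apply: (ler_cvg_to Jul ml); near=> k; exact/ltW/Ju.
exists l => h.
(* The quadratic polynomial [t |-> J (l + t h) - J l] is nonnegative. *)
have quad t : 0 <= 2 * t * (inner l h - L h) + t ^+ 2 * `|h| ^+ 2.
  have := le_trans Jl (mJ (l + t *: h)).
  rewrite /J LD LZ normD_sqr normrZ exprMn real_normK ?num_real// innerZr.
  lra.
have := quad (- (inner l h - L h) / (`|h| ^+ 2 + 1)).
set g := inner l h - L h; set q := `|h| ^+ 2.
have q1_gt0 : 0 < q + 1 by rewrite ltr_wpDl// exprn_ge0.
have -> : 2 * (- g / (q + 1)) * g + (- g / (q + 1)) ^+ 2 * q =
    - (g ^+ 2 * (q + 2)) / (q + 1) ^+ 2 by field; rewrite gt_eqF.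
rewrite pmulr_lge0 ?invr_gt0 ?exprn_gt0// oppr_ge0 pmulr_lle0; last first.
  by rewrite ltr_wpDl// exprn_ge0.
move=> g_le0; apply/esym/eqP; rewrite -subr_eq0 -sqrf_eq0.
by rewrite eq_le g_le0 sqr_ge0.
Unshelve. all: by end_near. Qed.

End Riesz.

Section Adjoint.
Context {R : realType} {X Y : hilbertType R} {A : {linear X -> Y}}.
Hypothesis A_cont : continuous A.

Lemma opnorm_le h : `|A h| <= opnorm A * `|h|.
Proof.
have [->|h_neq0] := eqVneq h 0; first by rewrite linear0 !normr0 mulr0.
have h_gt0 : 0 < `|h| by rewrite normr_gt0.
rewrite -ler_pdivrMr//; apply: ub_le_sup; last first.
  exists (`|h|^-1 *: h) => /=.
    by rewrite normrZ normfV normr_id mulVf// gt_eqF.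
  by rewrite linearZ normrZ normfV normr_id mulrC.
have [M [M_ge0 AM]] := continuous_linear_norm_le A A_cont.
exists M => _ [u /= u_le1 <-]; apply: le_trans (AM u) _.
by rewrite ler_piMr.
Qed.

(** The Riesz representative of [h |-> <A h, v>] is a witness for the choice made
    in [adjoint]. *)
Lemma adjointP v h : inner (A h) v = inner h (adjoint A v).
Proof.
have [|||u uP] := @riesz R X (fun h => inner (A h) v) (opnorm A * `|v|).
- by move=> a b; rewrite linearD innerDl.
- by move=> a b; rewrite linearZ innerZl.
- move=> a; apply: le_trans (norm_inner_le _ _) _.
  by rewrite -mulrA (mulrC `|v|) mulrA ler_wpM2r// opnorm_le.
- rewrite /adjoint; case: xgetP => [w _ -> //|/(_ u)]; case=> k /=.
  by rewrite uP innerC.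
Qed.

Lemma norm_adjoint_sqr_le v :
  `|adjoint A v| ^+ 2 <= opnorm A ^+ 2 * `|v| ^+ 2.
Proof.
set w := adjoint A v.
have [->|w_neq0] := eqVneq w 0.
  by rewrite normr0 expr0n/= mulr_ge0// sqr_ge0.
have w_gt0 : 0 < `|w| by rewrite normr_gt0.
have w_le : `|w| <= opnorm A * `|v|.
  rewrite -(ler_pM2r w_gt0) -expr2 -inner_norm -adjointP.
  apply: le_trans (inner_le _ _) _.
  by rewrite mulrAC ler_wpM2r// opnorm_le.
by rewrite -exprMn lerXn2r// nnegrE// (le_trans _ w_le).
Qed.

End Adjoint.

(** * Weak limits along filters *)

Lemma cvgR_unique {R : realType} {T : Type} {G : set_system T} {f : T -> R}
    {a b : R} : ProperFilter G -> f @ G --> a -> f @ G --> b -> a = b.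
Proof. by move=> pG; apply: cvg_unique; exact: Rhausdorff. Qed.

Section WeakLimits.
Context {R : realType} {X : hilbertType R}.
Implicit Types (x : nat -> X) (l z h : X) (G : set_system nat).

(** Arbitrary filters of indices are allowed so that ultrafilters can play the
    role of subsequences. *)
Definition weak_lim G x l := forall h, inner (x k) h @[k --> G] --> inner l h.

Lemma weak_cvg_lim x l : weak_lim \oo x l -> weak_cvg x l.
Proof.
move=> xl f f_cont.
have [M [_ fM]] := continuous_linear_norm_le f f_cont.
have [|||u fu] := @riesz R X f M.
- exact: linearD.
- by move=> a u; rewrite linearZ.
- exact: fM.
rewrite fu; under eq_fun do rewrite fu innerC.
by rewrite innerC; exact: xl.
Qed.

Lemma ultra_bounded_cvg {T : Type} {U : set_system T} {f : T -> R} {M : R} :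
  UltraFilter U -> (forall t, `|f t| <= M) -> exists a : R, f @ U --> a.
Proof.
move=> UU fM.
have [|a [_ aU]] := @segment_compact R (- M) M (f @ U) _.
  by apply: (@filterE _ U _ (f @^-1` _)) => t; rewrite /= in_itv/= -ler_norml.
exists a => B aB; have [//|UB] := in_ultra_setVsetC (f @^-1` B) UU.
by have [r [/= nBr Br]] := aU (~` B) B UB aB.
Qed.

(** Weak sequential compactness of bounded sequences: along an ultrafilter, the
    bounded scalar sequences [<x_k, h>] all converge; the limit is linear and
    bounded in [h], so the Riesz theorem provides the weak limit. *)
Lemma ultra_weak_lim {U : set_system nat} {x} {C : R} :
  UltraFilter U -> (forall k, `|x k| <= C) -> exists l, weak_lim U x l.
Proof.
move=> UU xC.
have le_inner h k : `|inner (x k) h| <= C * `|h|.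
  by apply: le_trans (norm_inner_le _ _) _; rewrite ler_wpM2r.
have /choice[L xL] h : exists a : R, inner (x k) h @[k --> U] --> a.
  exact: ultra_bounded_cvg UU (le_inner h).
have [|||l lL] := @riesz R X L C.
- move=> u v; apply: cvgR_unique (xL _) _.
  under eq_fun do rewrite innerDr.
  by apply: cvgD; exact: xL.
- move=> a u; apply: cvgR_unique (xL _) _.
  under eq_fun do rewrite innerZr.
  by apply: cvgMl_tmp; exact: xL.
- move=> h; apply: (ler_cvg_to (cvg_norm (xL h)) (cvg_cst (C * `|h|))).
  by near=> k; exact: le_inner.
- by exists l => h; rewrite -lL; exact: xL.
Unshelve. all: by end_near. Qed.

(** Opial's lemma. If [|x_k - z|] converges for two weak limits [z = l0, l1],
    then so does [<x_k, l1 - l0>]; its limits along the two filters being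
    [<l0, l1 - l0>] and [<l1, l1 - l0>], the weak limits agree. Compactness then
    turns uniqueness of the weak limit into weak convergence. *)
Lemma opial {x} {C : R} (S : set X) : (forall k, `|x k| <= C) ->
  (forall z, S z -> cvg (`|x k - z| ^+ 2 @[k --> \oo])) ->
  (forall G l, ProperFilter G -> \oo `<=` G -> weak_lim G x l -> S l) ->
  exists2 l, S l & weak_lim \oo x l.
Proof.
move=> xC Scvg Slim.
have weak_uniq G0 G1 l0 l1 : ProperFilter G0 -> ProperFilter G1 ->
    \oo `<=` G0 -> \oo `<=` G1 -> S l0 -> S l1 ->
    weak_lim G0 x l0 -> weak_lim G1 x l1 -> l1 = l0.
  move=> pG0 pG1 oG0 oG1 /Scvg/cvg_ex[c0 xc0] /Scvg/cvg_ex[c1 xc1] xl0 xl1.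
  pose q k := `|x k - l0| ^+ 2 - `|x k - l1| ^+ 2.
  have qc : q @ \oo --> c0 - c1 by exact: cvgB.
  pose d := `|l0| ^+ 2 - `|l1| ^+ 2.
  have qE k : q k = 2 * inner (x k) (l1 - l0) + d.
    by rewrite /q /d !normB_sqr innerBr; ring.
  have qlim G l : ProperFilter G -> \oo `<=` G -> weak_lim G x l ->
      c0 - c1 = 2 * inner l (l1 - l0) + d.
    move=> pG oG xl; apply: (cvgR_unique (f := q) pG).
      exact: cvg_trans (cvg_app _ oG) qc.
    rewrite (funext qE); apply: cvgD; last exact: cvg_cst.
    by apply: cvgMl_tmp; exact: xl.
  apply/subr0_eq/inner_eq0; rewrite innerBl.
  by have := qlim _ _ pG0 oG0 xl0; rewrite (qlim _ _ pG1 oG1 xl1); lra.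
(* The candidate limit [l0] comes from any ultrafilter of tails. *)
have [U0 [UU0 oU0]] := ultraFilterLemma eventually_filter.
have [l0 xl0] := ultra_weak_lim UU0 xC.
have Sl0 : S l0 by apply: Slim xl0.
exists l0 => // h B lB.
apply: contrapT => nB.
(* Otherwise some ultrafilter [U1] of tails stays outside the neighbourhood [B],
   and yet has the same weak limit. *)
pose P := [set k | ~ B (inner (x k) h)].
have pG : ProperFilter (within P \oo).
  apply: Build_ProperFilter; rewrite /within => P0; apply: nB.
  by move: P0; apply: (@filterS _ \oo) => k Pk; apply: contrapT => /Pk.
have [U1 [UU1 GU1]] := ultraFilterLemma pG.
have oU1 : \oo `<=` U1 by move=> Q oQ; apply: GU1; apply: filterS oQ => k Qk _.
have [l1 xl1] := ultra_weak_lim UU1 xC.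
have Sl1 : S l1 by apply: Slim xl1.
have l1E : l1 = l0 by apply: weak_uniq xl0 xl1.
have U1P : U1 P by apply: GU1; exact: withinT.
have U1B : U1 [set k | B (inner (x k) h)] by apply: xl1; rewrite l1E.
by have [k []] := filter_ex (filterI U1P U1B).
Qed.

(** Balls are weakly closed: [|l - c|^2] is the limit of
    [<x_k - c, l - c> <= r |l - c|]. *)
Lemma weak_lim_cball {G x l} {c : X} {r : R} : ProperFilter G ->
  (forall k, `|x k - c| <= r) -> weak_lim G x l -> `|l - c| <= r.
Proof.
move=> pG xr xl.
have r_ge0 : 0 <= r by apply: le_trans (xr 0%N).
have : inner (x k) (l - c) - inner c (l - c) @[k --> G] -->
    inner l (l - c) - inner c (l - c).
  by apply: cvgB; [exact: xl|exact: cvg_cst].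
move=> /ler_cvg_to/(_ (cvg_cst (r * `|l - c|))).
rewrite -innerBl inner_norm => le_r.
have {le_r} : `|l - c| ^+ 2 <= r * `|l - c|.
  apply: le_r; near=> k; rewrite -innerBl.
  by apply: le_trans (inner_le _ _) _; rewrite ler_wpM2r.
have [->//|lc_neq0] := eqVneq `|l - c| 0.
by rewrite expr2 ler_pM2r// lt_def lc_neq0 normr_ge0.
Unshelve. all: by end_near. Qed.

End WeakLimits.

(** * Sequences dominated by window averages *)

Lemma cvg_shift_dist0 {R : realType} {V : normedModType R} (u : nat -> V) :
  `|u m.+1 - u m| @[m --> \oo] --> 0 ->
  forall j, `|u (m + j)%N - u m| @[m --> \oo] --> 0.
Proof.
move=> u0; elim=> [|j IHj].
  by under eq_fun do rewrite addn0 subrr normr0; exact: cvg_cst.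
have uj0 : `|u (m + j).+1 - u (m + j)%N| @[m --> \oo] --> 0.
  by have := u0; rewrite -(cvg_shiftn j).
apply/norm_cvg0P.
have stepE m : u (m + j.+1)%N - u m =
    (u (m + j).+1 - u (m + j)%N) + (u (m + j)%N - u m).
  by rewrite addnS addrA subrK.
rewrite (funext stepE) -(addr0 0); apply: cvgD; exact/norm_cvg0P.
Qed.

Lemma cvg_sum0 {R : realType} (f : nat -> nat -> R) :
  (forall j, f j @ \oo --> 0) ->
  forall N, \sum_(j < N) f j m @[m --> \oo] --> 0.
Proof.
move=> f0; elim=> [|N IH].
  by under eq_fun do rewrite big_ord0; exact: cvg_cst.
under eq_fun do rewrite big_ord_recr/=.
have := cvgD IH (f0 N); rewrite addr0. exact.
Qed.

Section WindowAverages.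
Context {R : realType} {n : nat} {b d : nat -> R}.
Hypothesis n_gt0 : (0 < n)%N.
Hypothesis b_ge0 : forall m, 0 <= b m.
Hypothesis d_ge0 : forall m, 0 <= d m.
Hypothesis bd_le : forall m,
  n%:R * b (m + n)%N + d m <= \sum_(j < n) b (m + j)%N.

(** Weighting the window linearly makes the recurrence telescope:
    [lyapunov m.+1 - lyapunov m] is [n b_(m+n)] minus the window sum. *)
Definition lyapunov m := \sum_(j < n) j.+1%:R * b (m + j)%N.

Lemma lyapunovS m :
  lyapunov m.+1 + \sum_(j < n) b (m + j)%N = lyapunov m + n%:R * b (m + n)%N.
Proof.
rewrite /lyapunov; elim: n => [|N IH].
  by rewrite !big_ord0 mul0r.
rewrite !big_ord_recr/= addrACA IH addSnnS.
rewrite -[N.+1%:R]natr1; set B := b (m + N)%N; set B1 := b (m + N.+1)%N.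
by ring.
Qed.

Lemma lyapunov_le m : lyapunov m.+1 + d m <= lyapunov m.
Proof. by have := lyapunovS m; have := bd_le m; lra. Qed.

Lemma lyapunov_cvg : cvg (lyapunov @ \oo).
Proof.
apply: nonincreasing_is_cvgn.
  apply/nonincreasing_seqP => m.
  by apply: le_trans (lyapunov_le m); rewrite lerDl.
exists 0 => _ [m _ <-]; apply: sumr_ge0 => j _.
by rewrite mulr_ge0.
Qed.

Lemma window_gap_cvg0 : d @ \oo --> 0.
Proof.
have /cvg_ex[/= c Wc] := lyapunov_cvg.
apply: (squeeze_cvgr (f := cst 0) (h := fun m => lyapunov m - lyapunov m.+1)).
- near=> m; rewrite d_ge0/=; have := lyapunov_le m; lra.
- exact: cvg_cst.
rewrite -(subrr c); apply: cvgB => //.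
by have := Wc; rewrite -(cvg_shiftS lyapunov).
Unshelve. all: by end_near. Qed.

(** When increments vanish, [lyapunov m] is asymptotically a fixed multiple of
    [b m]. *)
Lemma window_cvg : `|b m.+1 - b m| @[m --> \oo] --> 0 -> cvg (b @ \oo).
Proof.
move=> /(@cvg_shift_dist0 R R^o) b_shift.
have /cvg_ex[/= c Wc] := lyapunov_cvg.
pose w : R := \sum_(j < n) j.+1%:R.
have w_gt0 : 0 < w.
  rewrite /w -(prednK n_gt0) big_ord_recl ltr_wpDr ?ltr01// sumr_ge0//.
have bE m : b m = w^-1 *
    (lyapunov m - \sum_(j < n) j.+1%:R * (b (m + j)%N - b m)).
  under eq_bigr do rewrite mulrBr.
  by rewrite sumrB subKr -mulr_suml mulKf// gt_eqF.
apply/cvg_ex; exists (w^-1 * (c - 0)); rewrite (funext bE).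
apply: cvgMl_tmp; apply: cvgB => //.
apply: (cvg_sum0 (fun j m => j.+1%:R * (b (m + j)%N - b m))) => j.
rewrite -(mulr0 j.+1%:R); apply: cvgMl_tmp.
exact/norm_cvg0P/b_shift.
Qed.

End WindowAverages.

(** * Averaged steps and the tangential cone condition *)

Lemma cvg0_sqr {R : realType} (f : nat -> R) :
  f m ^+ 2 @[m --> \oo] --> 0 -> `|f m| @[m --> \oo] --> 0.
Proof.
move=> f0; under eq_fun do rewrite -sqrtr_sqr.
rewrite -[X in nbhs X](sqrtr0 R).
exact: (continuous_cvg _ (@sqrt_continuous R 0) f0).
Qed.

(** Here [u m] is a step from [x m] that brings it closer to [z] by a gain [e m]
    controlling the length of the step, and [x] averages the last [n] steps. *)
Section AveragedSteps.
Context {R : realType} {X : hilbertType R} {n : nat} {x u : nat -> X}.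
Context {e : nat -> R} {K : R} {z : X}.
Hypothesis n_gt0 : (0 < n)%N.
Hypothesis e_ge0 : forall m, 0 <= e m.
Hypothesis x_mean : forall m, x (m + n)%N = n%:R^-1 *: \sum_(j < n) u (m + j)%N.
Hypothesis u_gap : forall m, `|u m - x m| ^+ 2 <= K * e m.
Hypothesis u_fejer : forall m, `|u m - z| ^+ 2 + e m <= `|x m - z| ^+ 2.

Let d m := \sum_(j < n) (`|u (m + j)%N - x (m + n)%N| ^+ 2 + e (m + j)%N).

Let d_ge0 m : 0 <= d m.
Proof. by apply: sumr_ge0 => j _; rewrite addr_ge0// exprn_ge0. Qed.

Let term_le_d j m : (j < n)%N ->
  `|u (m + j)%N - x (m + n)%N| ^+ 2 + e (m + j)%N <= d m.
Proof.
move=> jn; rewrite /d (bigD1 (Ordinal jn))//= lerDl sumr_ge0// => i _.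
by rewrite addr_ge0// exprn_ge0.
Qed.

Let sqdist_window m :
  n%:R * `|x (m + n)%N - z| ^+ 2 + d m <= \sum_(j < n) `|x (m + j)%N - z| ^+ 2.
Proof.
rewrite /d big_split/= addrA x_mean -(variance (fun j : 'I_n => u (m + j)%N))//.
by rewrite -big_split/=; apply: ler_sum => j _; exact: u_fejer.
Qed.

Let d_cvg0 : d @ \oo --> 0.
Proof.
apply: (window_gap_cvg0 (b := fun m => `|x m - z| ^+ 2) _ d_ge0 sqdist_window).
by move=> m; rewrite exprn_ge0.
Qed.

Lemma gain_cvg0 : e @ \oo --> 0.
Proof.
apply: (squeeze_cvgr _ (cvg_cst 0) d_cvg0); near=> m; rewrite e_ge0/=.
have := term_le_d 0%N m n_gt0; rewrite !addn0; apply: le_trans.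
by rewrite lerDr exprn_ge0.
Unshelve. all: by end_near. Qed.

(** Both iterates are close to [u m]: [x m.+1], as the mean of a window that
    contains [u m], by the variance term, and [x m] by the step length. *)
Lemma increment_cvg0 : `|x m.+1 - x m| @[m --> \oo] --> 0.
Proof.
have step0 : `|u m - x m| @[m --> \oo] --> 0.
  under eq_fun do rewrite -normr_id; apply: cvg0_sqr.
  apply: (squeeze_cvgr _ (cvg_cst 0) (_ : K * e m @[m --> \oo] --> 0)).
    by near=> m; rewrite exprn_ge0//= u_gap.
  by rewrite -(mulr0 K); apply: cvgMl_tmp; exact: gain_cvg0.
have mean0 : `|x m.+1 - u m| @[m --> \oo] --> 0.
  (* [u (m + n.-1)] is the last point of the window averaged in [x (m + n)]. *)
  rewrite -(cvg_shiftn n.-1) /=.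
  under eq_fun do rewrite -normr_id; apply: cvg0_sqr.
  apply: (squeeze_cvgr _ (cvg_cst 0) d_cvg0); near=> m; rewrite exprn_ge0//=.
  have := term_le_d n.-1 m; rewrite prednK// => /(_ (leqnn _)).
  apply: le_trans; rewrite distrC -addnS prednK// lerDl.
  exact: e_ge0.
apply: (squeeze_cvgr (f := cst 0)
  (h := fun m => `|x m.+1 - u m| + `|u m - x m|)); last first.
- by have := cvgD mean0 step0; rewrite addr0; exact.
- exact: cvg_cst.
near=> m; rewrite normr_ge0/=; apply: le_trans (ler_normD _ _).
by rewrite addrA subrK.
Unshelve. all: by end_near. Qed.

Lemma sqdist_cvg (C : R) : (forall m, `|x m - z| <= C) ->
  cvg (`|x m - z| ^+ 2 @[m --> \oo]).
Proof.
move=> xC; have C_ge0 : 0 <= C by apply: le_trans (xC 0%N).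
apply: (window_cvg n_gt0 _ d_ge0 sqdist_window) => [m|].
  by rewrite exprn_ge0.
apply: (squeeze_cvgr (f := cst 0)
  (h := fun m => 2 * C * `|x m.+1 - x m|)); last first.
- by rewrite -(mulr0 (2 * C)); apply: cvgMl_tmp; exact: increment_cvg0.
- exact: cvg_cst.
near=> m; rewrite normr_ge0/=.
rewrite subr_sqr normrM mulrC ler_pM//.
  by apply: le_trans (ler_normD _ _) _; rewrite !normr_id mulr_natl mulr2n lerD.
apply: le_trans (ler_dist_dist _ _) _.
by rewrite opprB addrA subrK.
Unshelve. all: by end_near. Qed.

End AveragedSteps.

Definition landweber {R : realType} {X Y : hilbertType R} (F : X -> Y)
    (dF : X -> {linear X -> Y}) (s : R) (y : Y) (x : X) : X :=
  x - s *: adjoint (dF x) (F x - y).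

Section TangentialCone.
Context {R : realType} {X Y : hilbertType R}.
Context {F : X -> Y} {dF : X -> {linear X -> Y}} {B : set X} {eta : R}.
Hypothesis eta_ge0 : 0 <= eta.
Hypothesis eta_lt : eta < 2^-1.
Hypothesis dF_cont : forall x, B x -> continuous (dF x).
Hypothesis cone : forall x1 x2, B x1 -> B x2 ->
  `|F x1 - F x2 - dF x1 (x1 - x2)| <= eta * `|F x1 - F x2|.

(** The step size condition absorbs the norm of the adjoint. *)
Lemma landweber_gap (s : R) (y : Y) (x : X) : B x -> 0 <= s ->
  s * opnorm (dF x) ^+ 2 <= 1 ->
  `|landweber F dF s y x - x| ^+ 2 <= s * `|F x - y| ^+ 2.
Proof.
move=> Bx s_ge0 s_le.
rewrite /landweber addrAC subrr add0r normrN normrZ exprMn.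
rewrite real_normK ?num_real//.
set r := F x - y.
apply: le_trans (_ : s ^+ 2 * (opnorm (dF x) ^+ 2 * `|r| ^+ 2) <= _).
  rewrite ler_wpM2l ?exprn_ge0//.
  exact: norm_adjoint_sqr_le (dF_cont _ Bx) _.
by rewrite expr2 -mulrA ler_wpM2l// mulrA ler_piMl// exprn_ge0.
Qed.

(** With [r = F x - F z], the cone condition gives
    [<r, dF x (x - z)> >= (1 - eta) |r|^2], whereas the quadratic term of the
    step is at most [s |r|^2]. *)
Lemma landweber_fejer (s : R) (x z : X) : B x -> B z -> 0 <= s ->
  s * opnorm (dF x) ^+ 2 <= 1 ->
  `|landweber F dF s (F z) x - z| ^+ 2 + s * (1 - 2 * eta) * `|F x - F z| ^+ 2
    <= `|x - z| ^+ 2.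
Proof.
move=> Bx Bz s_ge0 s_le.
have := landweber_gap s (F z) x Bx s_ge0 s_le.
rewrite /landweber (addrAC x _ (- x)) subrr add0r normrN.
rewrite (addrAC x _ (- z)) (normB_sqr (x - z)) innerZr.
set r := F x - F z; set w := adjoint _ _.
have w_ge : (1 - eta) * `|r| ^+ 2 <= inner (x - z) w.
  rewrite -(adjointP (dF_cont _ Bx)) innerC.
  have := inner_le r (r - dF x (x - z)); rewrite innerBr inner_norm.
  have := ler_wpM2l (normr_ge0 r) (cone _ _ Bx Bz); rewrite -/r.
  by set a := inner _ _; rewrite expr2; lra.
have := ler_wpM2l s_ge0 w_ge.
set a := `|x - z| ^+ 2; set b := `|r| ^+ 2; set c := inner _ _.
by set f := `|s *: w| ^+ 2; lra.
Qed.

(** As [eta < 1/2], at least half of [F x1 - F x2] comes from the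
    linearisation. *)
Lemma cone_lipschitz (M : R) (x1 x2 : X) : B x1 -> B x2 ->
  opnorm (dF x1) <= M -> `|F x1 - F x2| <= 2 * M * `|x1 - x2|.
Proof.
move=> B1 B2 leM.
have := ler_normD (F x1 - F x2 - dF x1 (x1 - x2)) (dF x1 (x1 - x2)).
rewrite subrK.
have := cone _ _ B1 B2; have := opnorm_le (dF_cont _ B1) (x1 - x2).
have := ler_wpM2r (normr_ge0 (x1 - x2)) leM.
have : eta * `|F x1 - F x2| <= 2^-1 * `|F x1 - F x2|.
  by rewrite ler_wpM2r// ltW.
lra.
Qed.

(** The graph of [F] is weakly-strongly closed, because the linearisation of [F]
    at the weak limit is weakly continuous. *)
Lemma cone_demiclosed {G : set_system nat} {x : nat -> X} {l : X} {y : Y} :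
  ProperFilter G -> (forall k, B (x k)) -> B l -> weak_lim G x l ->
  `|F (x k) - y| @[k --> G] --> 0 -> F l = y.
Proof.
move=> pG Bx Bl xl Fx.
apply/subr0_eq; move wE: (F l - y) => w; pose p := adjoint (dF l) w.
have le_k k : (1 - eta) * `|w| ^+ 2 <=
    (1 + eta) * `|w| * `|F (x k) - y| + (inner l p - inner (x k) p).
  have := cone _ _ Bl (Bx k).
  have -> : F l - F (x k) = w - (F (x k) - y) by rewrite -wE opprB addrA subrK.
  set r := F (x k) - y => cone_k.
  have := inner_le w (w - r - dF l (l - x k)).
  rewrite (innerBr w (w - r)) (innerBr w w) inner_norm.
  rewrite (innerC w (dF l _)) (adjointP (dF_cont _ Bl)) -/p.
  rewrite innerBl.
  have := inner_le w r.
  have := ler_wpM2l (mulr_ge0 eta_ge0 (normr_ge0 w)) (ler_normB w r).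
  have := ler_wpM2l (normr_ge0 w) cone_k.
  set a := `|w|; set b := `|r|; set c := `|w - r|; set d := `|w - r - _|.
  set e := inner w r; set f := inner l p; set g := inner (x k) p.
  by rewrite !expr2; lra.
have : (1 + eta) * `|w| * `|F (x k) - y| + (inner l p - inner (x k) p)
    @[k --> G] --> (1 + eta) * `|w| * 0 + (inner l p - inner l p).
  apply: cvgD; first exact: cvgMl_tmp.
  by apply: cvgB; [exact: cvg_cst|exact: xl].
rewrite mulr0 subrr addr0 => lim0.
have : (1 - eta) * `|w| ^+ 2 <= 0.
  apply: (ler_cvg_to (cvg_cst _) lim0).
  by near=> k; exact: le_k.
rewrite pmulr_rle0; last first.
  by rewrite subr_gt0 (lt_trans eta_lt)// invf_lt1 ?ltr1n.
by rewrite exprn_even_le0//= normr_eq0 => /eqP.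
Unshelve. all: by end_near. Qed.

End TangentialCone.

(** * The averaged Kaczmarz iteration *)

Lemma cyc_window {n : nat} (n_gt0 : (0 < n)%N) (i : 'I_n) (m : nat) :
  exists2 j, (j < n)%N & cyc n_gt0 (m + j).+1 = i.
Proof.
(* The least [j] with [m + j] congruent to [i] modulo [n]. *)
exists ((i + (n - m %% n)) %% n)%N; first by rewrite ltn_pmod.
apply/val_inj; rewrite /= modnDmr addnCA {1}(divn_eq m n) -addnA.
rewrite subnKC; last by rewrite ltnW// ltn_pmod.
by rewrite addnCA modnMDl modnDr modn_small.
Qed.

(** The iteration re-indexed from [0]: [x m] and [s m] carry the number [m.+1], as
    the argument of [cyc] in [c] shows. *)
Section Avek.
Context {R : realType} {n : nat} {n_gt0 : (0 < n)%N}.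
Context {X : hilbertType R} {Y : 'I_n -> hilbertType R}.
Context {F : forall i, X -> Y i} {dF : forall i, X -> {linear X -> Y i}}.
Context {y : forall i, Y i} {x0 : X} {rho eta sigma : R}.
Context {x : nat -> X} {s : nat -> R}.
Let B := cball x0 rho.
Let c m := cyc n_gt0 m.+1.
Let u m := landweber (F (c m)) (dF (c m)) (s m) (y (c m)) (x m).
Let residual m := `|F (c m) (x m) - y (c m)|.

Hypothesis eta_ge0 : 0 <= eta.
Hypothesis eta_lt : eta < 2^-1.
Hypothesis sigma_gt0 : 0 < sigma.
Hypothesis dF_cont : forall i z, B z -> continuous (dF i z).
Hypothesis dF_bounded : forall i,
  exists M, forall z, B z -> opnorm (dF i z) <= M.
Hypothesis cone : forall i x1 x2, B x1 -> B x2 ->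
  `|F i x1 - F i x2 - dF i x1 (x1 - x2)| <= eta * `|F i x1 - F i x2|.
Hypothesis solvable : exists2 z, cball x0 (rho / 3) z & solutions F y z.
Hypothesis x_init : forall m, (m < n)%N -> cball x0 (rho / 3) (x m).
Hypothesis s_ge : forall m, sigma <= s m.
Hypothesis s_small : forall i m z, B z -> s m * opnorm (dF i z) ^+ 2 <= 1.
Hypothesis x_mean : forall m, x (m + n)%N = n%:R^-1 *: \sum_(j < n) u (m + j)%N.

Let s_ge0 m : 0 <= s m. Proof. by rewrite (le_trans (ltW sigma_gt0)). Qed.

Let e m := s m * (1 - 2 * eta) * residual m ^+ 2.

Let gamma_gt0 : 0 < 1 - 2 * eta.
Proof. by rewrite subr_gt0 -ltr_pdivlMl// mulr1. Qed.

Let e_ge0 m : 0 <= e m.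
Proof. by rewrite /e !mulr_ge0 ?(ltW gamma_gt0) ?exprn_ge0 /residual. Qed.

Let u_fejer m z : B (x m) -> B z -> solutions F y z ->
  `|u m - z| ^+ 2 + e m <= `|x m - z| ^+ 2.
Proof.
move=> Bx Bz Fz; rewrite /u /e /residual -(Fz (c m)).
by apply: (landweber_fejer (dF_cont (c m)) (cone (c m))) => //; exact: s_small.
Qed.

(** The initial points are within [2 rho / 3] of a solution [z] of the small
    ball. Steps from [B] do not increase the distance to [z], nor does averaging,
    and the ball of radius [2 rho / 3] around [z] lies in [B]. *)
Lemma avek_in_ball m : B (x m).
Proof.
have [z zx0 Fz] := solvable.
have rho_ge0 : 0 <= rho.
  by move: (le_trans (normr_ge0 _) zx0); rewrite pmulr_lge0// invr_gt0.
have Bz : B z by apply: le_trans zx0 _; rewrite ler_pdivrMr// ler_peMr// ler1n.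
have in_ball w : `|w - z| <= 2 * (rho / 3) -> B w.
  move=> wz; rewrite /B /cball/= -[w](subrK z) -addrA.
  by apply: le_trans (ler_normD _ _) _; have := zx0; rewrite /cball/=; lra.
apply: (in_ball); elim/ltn_ind: m => m IH.
have [mn|nm] := ltnP m n.
  rewrite -[x m](subrK x0) -addrA; apply: le_trans (ler_normD _ _) _.
  have := zx0; have := x_init m mn; rewrite /cball/= (distrC z); lra.
rewrite -(subnK nm) x_mean.
apply: mean_cball => //; first by rewrite !mulr_ge0// invr_ge0.
move=> j; set k := (m - n + j)%N.
have km : (k < m)%N by rewrite -[ltnRHS](subnK nm) ltn_add2l.
apply: le_trans (IH k km).
rewrite -(ler_pXn2r (ltn0Sn 1)) ?nnegrE//.
by apply: le_trans (u_fejer k z (in_ball _ (IH k km)) Bz Fz); rewrite lerDl.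
Qed.

Let u_gap m : `|u m - x m| ^+ 2 <= (1 - 2 * eta)^-1 * e m.
Proof.
have -> : (1 - 2 * eta)^-1 * e m = s m * residual m ^+ 2.
  by rewrite /e (mulrC (s m)) -!mulrA mulKf// gt_eqF.
apply: (landweber_gap (dF_cont (c m))) => //; first exact: avek_in_ball.
exact/s_small/avek_in_ball.
Qed.

Let small_solution_fejer : exists z, forall m,
  `|u m - z| ^+ 2 + e m <= `|x m - z| ^+ 2.
Proof.
have [z zx0 Fz] := solvable; exists z => m; apply: u_fejer => //.
  exact: avek_in_ball.
apply: le_trans zx0 _; rewrite ler_pdivrMr// ler_peMr ?ler1n//.
by apply: le_trans (avek_in_ball 0).
Qed.

Lemma avek_increment_cvg0 : `|x m.+1 - x m| @[m --> \oo] --> 0.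
Proof.
have [z z_fejer] := small_solution_fejer.
exact: (increment_cvg0 n_gt0 e_ge0 x_mean u_gap z_fejer).
Qed.

Let residual_cvg0 : residual @ \oo --> 0.
Proof.
have [z z_fejer] := small_solution_fejer.
have e0 := gain_cvg0 n_gt0 e_ge0 x_mean z_fejer.
have sg_gt0 : 0 < sigma * (1 - 2 * eta) by rewrite mulr_gt0.
apply/norm_cvg0P; apply: cvg0_sqr.
apply: (squeeze_cvgr (f := cst 0)
  (h := fun m => (sigma * (1 - 2 * eta))^-1 * e m)); last first.
- by rewrite -(mulr0 (sigma * (1 - 2 * eta))^-1); exact: cvgMl_tmp.
- exact: cvg_cst.
near=> m; rewrite sqr_ge0 ler_pdivlMl// /e ler_wpM2r ?sqr_ge0//.
by rewrite ler_wpM2r// ltW.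
Unshelve. all: by end_near. Qed.

(** Equation [i] is used once in every window, and the iterates of a window stay
    close to each other. *)
Lemma avek_residual_cvg0 i : `|F i (x m) - y i| @[m --> \oo] --> 0.
Proof.
have [M FM] := dF_bounded i.
have inc0 j : `|x (m + j)%N - x m| @[m --> \oo] --> 0.
  exact: (cvg_shift_dist0 x avek_increment_cvg0).
pose f j m := 2 * M * `|x (m + j)%N - x m| + residual (m + j)%N.
have f_ge0 j m : 0 <= f j m.
  rewrite /f addr_ge0// /residual//.
  have lip := cone_lipschitz eta_lt (dF_cont i) (cone i) M.
  apply: le_trans (lip _ _ _ _ _) => //; try exact: avek_in_ball.
  exact/FM/avek_in_ball.
have f0 j : f j @ \oo --> 0.
  have : 2 * M * `|x (m + j)%N - x m| + residual (m + j)%N @[m --> \oo] -->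
      2 * M * 0 + 0.
    apply: cvgD; first exact: cvgMl_tmp.
    by have := residual_cvg0; rewrite -(cvg_shiftn j).
  by rewrite mulr0 addr0.
apply: (squeeze_cvgr _ (cvg_cst 0) (cvg_sum0 f f0 n)).
near=> m; rewrite normr_ge0/=.
have [j jn cij] := cyc_window n_gt0 i m.
apply: le_trans (_ : f j m <= _); last first.
  by rewrite (bigD1 (Ordinal jn))//= lerDl sumr_ge0.
rewrite /f /residual /c cij -[X in X - y i](subrK (F i (x (m + j)%N))) -addrA.
apply: le_trans (ler_normD _ _) _; rewrite lerD2r distrC.
apply: (cone_lipschitz eta_lt (dF_cont i) (cone i)); try exact: avek_in_ball.
exact/FM/avek_in_ball.
Unshelve. all: by end_near. Qed.

Lemma avek_weak_lim :
  exists2 l, (B `&` solutions F y) l & weak_lim \oo x l.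
Proof.
apply: (@opial _ _ _ (rho + `|x0|)) => [k|z [Bz Fz]|G l pG oG xl].
- rewrite -[x k](subrK x0); apply: le_trans (ler_normD _ _) _.
  by rewrite lerD2r; exact: avek_in_ball.
- apply: (sqdist_cvg n_gt0 e_ge0 x_mean u_gap _ (rho + rho)).
    by move=> m; apply: u_fejer => //; exact: avek_in_ball.
  move=> m; rewrite -[x m](subrK x0) -addrA.
  apply: le_trans (ler_normD _ _) _; rewrite (distrC x0) lerD//.
  exact: avek_in_ball.
- have Bl : B l by apply: (weak_lim_cball pG avek_in_ball xl).
  split=> // i.
  apply: (cone_demiclosed eta_ge0 eta_lt (dF_cont i) (cone i) pG avek_in_ball
    Bl xl).
  exact: cvg_trans (cvg_app _ oG) (avek_residual_cvg0 i).
Qed.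

(** The steps lie in the ranges of the adjoints [dF i (x l)^*], hence stay
    orthogonal to every direction that all derivatives annihilate. *)
Lemma avek_orthogonal h : (forall m, (m < n)%N -> x m = x0) ->
  (forall i z, B z -> dF i z h = 0) -> forall m, inner (x m - x0) h = 0.
Proof.
move=> init dFh; elim/ltn_ind=> m IH.
have [mn|nm] := ltnP m n; first by rewrite init// subrr inner0l.
have u_orth (j : 'I_n) : inner (u (m - n + j)%N) h = inner x0 h.
  have km : (m - n + j < m)%N by rewrite -[ltnRHS](subnK nm) ltn_add2l.
  apply/eqP; rewrite -subr_eq0 -innerBl /u /landweber addrAC innerBl IH// sub0r.
  rewrite innerZl innerC -(adjointP (dF_cont _ _ (avek_in_ball _))).
  by rewrite dFh ?inner0l ?mulr0 ?oppr0//; exact: avek_in_ball.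
rewrite -(subnK nm) x_mean innerBl innerZl inner_suml.
under eq_bigr do rewrite u_orth.
rewrite sumr_const card_ord -[inner x0 h *+ n]mulr_natl mulKf ?subrr//.
by rewrite pnatr_eq0 -lt0n.
Qed.

End Avek.

(** * Convergence theorem *)

Lemma weak_cvg_shiftS {R : realType} {X : hilbertType R} {x : nat -> X}
    {l : X} :
  weak_cvg (fun m => x m.+1) l -> weak_cvg x l.
Proof.
by move=> xl f f_cont; have := xl f f_cont; rewrite -(cvg_shiftS (f \o x)).
Qed.

Lemma uniform_lt {R : realType} {n : nat} (eta : 'I_n -> R) (a : R) : 0 < a ->
  (forall i, eta i < a) -> exists b, [/\ 0 <= b, b < a & forall i, eta i <= b].
Proof.
move=> a_gt0 eta_lt; exists (\big[Num.max/0]_i eta i); split.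
- exact: bigmax_ge_id.
- exact: bigmax_lt.
- by move=> i; exact: le_bigmax.
Qed.

(** By Pythagoras, [|xp - x0|^2 = |l - x0|^2 + |l - xp|^2]. *)
Lemma min_norm_unique {R : realType} {X : hilbertType R} (x0 xp l : X) :
  `|xp - x0| <= `|l - x0| -> inner (l - x0) (l - xp) = 0 -> l = xp.
Proof.
move=> le_xp orth; apply/subr0_eq/eqP; rewrite -normr_eq0 -sqrf_eq0.
have xpE : xp - x0 = (l - x0) - (l - xp).
  by rewrite opprB [RHS]addrC addrA subrK.
have : `|xp - x0| ^+ 2 <= `|l - x0| ^+ 2 by rewrite lerXn2r ?nnegrE.
rewrite xpE normB_sqr orth mulr0 subr0 gerDl => le0.
by rewrite eq_le le0 sqr_ge0.
Qed.

(* Sequences are indexed from 1: x 0 and s 0 are unconstrained and unused. *)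
Theorem theorem2p7 (R : realType) (n : nat) (n_gt0 : (0 < n)%N)
    (X : hilbertType R) (Y : 'I_n -> hilbertType R)
    (D : 'I_n -> set X) (F : forall i, X -> Y i)
    (dF : forall i, X -> {linear X -> Y i})
    (y : forall i, Y i) (x0 : X) (rho : R)
    (F_C1 : forall i, continuously_frechet (D i) (F i) (dF i))
    (rho_gt0 : 0 < rho)
    (ball_dom : cball x0 rho `<=` \bigcap_i D i)
    (dF_bounded : forall i,
      has_ubound [set opnorm (dF i x) | x in cball x0 rho])
    (tangential_cone : forall i, exists eta : R, 0 <= eta < 2^-1 /\
      forall x1 x2, cball x0 rho x1 -> cball x0 rho x2 ->
        `|F i x1 - F i x2 - dF i x1 (x1 - x2)| <= eta * `|F i x1 - F i x2|)
    (solvable : exists2 z, cball x0 (rho / 3) z & solutions F y z)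
    (x : nat -> X) (s : nat -> R)
    (x_init : forall k, (1 <= k <= n)%N -> cball x0 (rho / 3) (x k))
    (s_gt0 : forall k, (1 <= k)%N -> 0 < s k)
    (s_small : forall i k z, (1 <= k)%N -> cball x0 rho z ->
      s k * opnorm (dF i z) ^+ 2 <= 1)
    (s_inf : 0 < inf [set s k | k in [set k | (1 <= k)%N]])
    (avek : forall k, (n <= k)%N ->
      x k.+1 = n%:R^-1 *: \sum_((k - n).+1 <= l < k.+1)
        (x l - s l *: adjoint (dF (cyc n_gt0 l) (x l))
                        (F (cyc n_gt0 l) (x l) - y (cyc n_gt0 l)))) :
  (exists xs, [/\ cball x0 rho xs, solutions F y xs & weak_cvg x xs]) /\
  ((forall k, (1 <= k <= n)%N -> x k = x0) ->
   forall xp, is_min_norm_solution F y x0 rho xp ->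
     (forall z, cball x0 rho z ->
        null_space (fun i => dF i xp) `<=` null_space (fun i => dF i z)) ->
     weak_cvg x xp).
Proof.
have /choice[etas etasP] := tangential_cone.
have [eta [eta_ge0 eta_lt etas_le]] :
    exists b, [/\ 0 <= b, b < 2^-1 & forall i, etas i <= b].
  apply: uniform_lt; first by rewrite invr_gt0.
  by move=> i; have [/andP[]] := etasP i.
have cone i x1 x2 : cball x0 rho x1 -> cball x0 rho x2 ->
    `|F i x1 - F i x2 - dF i x1 (x1 - x2)| <= eta * `|F i x1 - F i x2|.
  move=> B1 B2; have [_ /(_ _ _ B1 B2)] := etasP i.
  by move=> /le_trans; apply; rewrite ler_wpM2r.
have dF_cont i z : cball x0 rho z -> continuous (dF i z).
  by move=> /ball_dom/(_ i Logic.I)/F_C1[[]].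
have dF_bd i : exists M, forall z, cball x0 rho z -> opnorm (dF i z) <= M.
  by have [M FM] := dF_bounded i; exists M => z Bz; apply: FM; exists z.
pose sigma := inf [set s k | k in [set k | (1 <= k)%N]].
have s_ge m : sigma <= s m.+1.
  apply: ge_inf; last by exists m.+1.
  by exists 0 => _ [k /= k1 <-]; exact/ltW/s_gt0.
have init' m : (m < n)%N -> cball x0 (rho / 3) (x m.+1).
  by move=> mn; exact: x_init.
have mean' m : x (m + n).+1 = n%:R^-1 *: \sum_(j < n)
    landweber (F (cyc n_gt0 (m + j).+1)) (dF (cyc n_gt0 (m + j).+1))
      (s (m + j).+1) (y (cyc n_gt0 (m + j).+1)) (x (m + j).+1).
  rewrite avek ?leq_addl// addnK -[m.+1]add0n big_addn subSS addKn big_mkord.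
  by congr (_ *: _); apply: eq_bigr => j _; rewrite addnS (addnC j).
have small' i m z (Bz : cball x0 rho z) := s_small i m.+1 z isT Bz.
have [l [Bl Fl] xl] :=
  avek_weak_lim (x := fun m => x m.+1) (s := fun m => s m.+1)
    eta_ge0 eta_lt s_inf dF_cont dF_bd cone solvable init' s_ge small' mean'.
have x_l : weak_cvg x l by exact/weak_cvg_shiftS/weak_cvg_lim.
split; first by exists l; split.
move=> x_eq xp [[Bxp Fxp] xp_min] null_incl.
suff <- : l = xp by [].
apply: (@min_norm_unique _ _ x0).
  rewrite xp_min; apply: ge_inf; last by exists l.
  by exists 0 => _ [w _ <-].
(* The cone condition at two solutions bounds the linear term by zero. *)
have null_h i : dF i xp (l - xp) = 0.
  have := cone i xp l Bxp Bl.
  rewrite Fxp Fl subrr normr0 mulr0 sub0r normrN normr_le0 => /eqP dF0.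
  by rewrite -opprB linearN dF0 oppr0.
have x_orth m : inner (x m.+1 - x0) (l - xp) = 0.
  apply: (avek_orthogonal (x := fun m => x m.+1) (s := fun m => s m.+1)
    eta_lt s_inf dF_cont cone solvable init' s_ge small' mean').
  - by move=> k kn; exact: x_eq.
  - by move=> i z Bz; exact: (null_incl z Bz).
apply/eqP; rewrite innerBl subr_eq0; apply/eqP.
apply: (cvgR_unique _ (xl (l - xp))).
have x_inner m : inner (x m.+1) (l - xp) = inner x0 (l - xp).
  by rewrite -[x m.+1](subrK x0) innerDl x_orth add0r.
by rewrite (funext x_inner); exact: cvg_cst.
Qed.
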